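(* Suppose that $\mathfrak g$ is either $\mathfrak{sp}(\mathbb V)$ or $\mathfrak{so}(\mathbb V)$, where $\mathbb V$ is a finite-dimensional vector space over $\mathbb F$ equipped with a non-degenerate skew-symmetric, respectively symmetric, bilinear form, and let $e\in\mathfrak g$ be a nilpotent element that is reachable, i.e. $e\in[\mathfrak g_e,\mathfrak g_e]$. Then $[\mathfrak g(1)_e,\mathfrak g(\lambda)_e]=\mathfrak g(\lambda+1)_e$ for all integers $\lambda\ge 0$.
   Context: $\mathbb F$ is an algebraically closed field of characteristic $0$. $\mathfrak g_e=\{\xi\in\mathfrak g\mid[\xi,e]=0\}$ is the centraliser of $e$. The nilpotent element $e$ is included in an $\mathfrak{sl}_2$-triple $\{e,h,f\}\subset\mathfrak g$ (so $[h,e]=2e$, $[h,f]=-2f$, $[e,f]=h$; for $e=0$ take $h=f=0$). For an integer $\lambda$, $\mathfrak g(\lambda)=\{\xi\in\mathfrak g\mid [h,\xi]=\lambda\xi\}$ and $\mathfrak g(\lambda)_e=\mathfrak g(\lambda)\cap\mathfrak g_e$. For subspaces $A,B\subset\mathfrak g$, $[A,B]$ is the linear span of all $[a,b]$ with $a\in A$, $b\in B$. *)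

(* Defs.v *)
From mathcomp Require Import all_boot all_order all_algebra.
From mathcomp Require Import boolp classical_sets.
Set Implicit Arguments.
Unset Strict Implicit.
Unset Printing Implicit Defensive.
Import GRing.Theory.
Local Open Scope classical_set_scope.
Local Open Scope ring_scope.

Section LieEnd.
Variables (F : fieldType) (V : vectType F).
Implicit Types (x y e h f : 'End(V)) (g A B : set 'End(V)) (l : int).

Definition lie x y : 'End(V) := (x \o y)%VF - (y \o x)%VF.

(* The linear span of a possibly infinite set is the union of the spans <<s>>
   of the finite sequences s of its elements. *)
Definition lspan A : set 'End(V) :=
  [set x | exists2 s : seq 'End(V), {in s, forall y, A y} & x \in <<s>>%VS].

Definition lie_prod A B : set 'End(V) :=
  lspan [set lie a b | a in A & b in B].

(* The Lie algebra of the group of isometries of phi: so(V) when eps = false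
   (phi symmetric) and sp(V) when eps = true (phi skew-symmetric). *)
Definition isometry_lie (eps : bool) (phi : {hermitian V for eps & idfun}) :
    set 'End(V) :=
  [set x | forall u v : V, phi (x u) v + phi u (x v) = 0].

(* 'End(V) has no ring structure when V = 0, so the k-th power of e is written
   as an iterated composition. *)
Definition nilpotent_end e : Prop :=
  exists k : nat, iter k (fun x => (e \o x)%VF) \1%VF = 0.

Definition sl2_triple e h f : Prop :=
  [/\ lie h e = 2%:R *: e, lie h f = - (2%:R *: f) & lie e f = h].

Definition centraliser g e : set 'End(V) := [set x | g x /\ lie x e = 0].

Definition weight_space g h l : set 'End(V) :=
  [set x | g x /\ lie h x = l%:~R *: x].

Definition reachable g e : Prop :=
  lie_prod (centraliser g e) (centraliser g e) e.

Definition weight_centraliser g e h l : set 'End(V) :=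
  weight_space g h l `&` centraliser g e.

End LieEnd.

(* Main.v *)
Require Import Defs.
From HB Require Import structures.
From mathcomp Require Import all_boot all_order all_algebra.
From mathcomp Require Import boolp classical_sets.
From mathcomp Require Import zify ring.
Set Implicit Arguments.
Unset Strict Implicit.
Unset Printing Implicit Defensive.
Import GRing.Theory passmx.
Local Open Scope classical_set_scope.
Local Open Scope ring_scope.

(** Write g for the Lie algebra of phi and M_m (lowest m below) for the space
    of a with f a = 0 and h a = - m a, so that V is the sum of the strings
    a, e a, ..., e^m a with a in M_m.

    Explicit elements of the centraliser. The rule
    (u, v) |-> u.v = (w |-> phi(w, u) v - (-1)^eps phi(w, v) u) identifies the
    exterior or the symmetric square of V with g, as g-modules.
    For a in M_m, b in M_m' and N >= m, m', the alternating sum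
      C_N(a, b) = sum_(k <= N) (-1)^k (e^k a).(e^(N-k) b)
    (highest_op N a b) telescopes to 0 under ad e and has weight 2N - m - m'.
    These elements span every g(l)_e (weight_centraliser_span): choosing dual
    bases of M_m for the pairing phi(e^m a, b), which is nondegenerate
    (lowest_nondeg), one writes the identity of V as a sum of operators
    commuting with e, each supported on strings of one length
    (resolution_of_identity), and x = x o 1 becomes a sum of C_N's.

    Brackets. If x in g commutes with e, then
      [x, C_N(a, b)] = C_N(x a, b) + C_N(a, x b),
    and C_N(a, e b) = C_(N+1)(a, b). The element x = C_(n+1)(p, q) of weight 1,
    with p in M_(n+1) and q in M_n, sends M_(n+1) to the line of q, M_n to the
    line of e p, and kills every other M_m (weight1_act). With q' in M_n
    such that phi(e^n q', q) <> 0, the bracket of C_(n+1)(b, q) with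
    C_(N-1)(a, q') is a nonzero multiple of C_N(a, b) when b lies in M_(n+1)
    and a in M_m with m < n. In the cases m = n and m = n + 1 a second term
    appears; the former is settled by the symmetry of C_N in its arguments,
    the latter by induction on m.

    Reachability. The bracket above needs M_n <> 0 as soon as M_(n+1) <> 0.
    Suppose M_m = 0 and M_(m+1) <> 0. Then K = ker e /\ im e^(m+1) is nonzero,
    equals ker e /\ im e^m, and the map e : e^-1(K) /\ im e^m -> K has a linear
    section S. For x commuting with e, the operator D x = x S - S x maps K to
    K, and D is a derivation, so the trace of D vanishes on commutators; but
    D e is the identity of K, whose trace is dim K <> 0. Hence e would not be
    reachable (section_obstruction, reachable_lowest_pred). *)

(** * Scalars and powers of endomorphisms *)

Section CharacteristicZero.
Variable F : fieldType.
Hypothesis charF0 : [pchar F] =i pred0.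

Lemma natr_neq0_char0 n : n.+1%:R != 0 :> F.
Proof. by move/pcharf0P: charF0 => ->. Qed.

Lemma natr_inj_char0 : injective (fun n => n%:R : F).
Proof.
move=> i j; wlog le_ij : i j / (i <= j)%N => [wlg ij|].
  by case/orP: (leq_total i j) => le; [|symmetry]; apply: wlg.
move=> /eqP; rewrite eq_sym -subr_eq0 -natrB //.
move/pcharf0P: charF0 => ->; rewrite subn_eq0 => le_ji.
by apply/eqP; rewrite eqn_leq le_ij.
Qed.

Lemma intr_eq0_char0 (n : int) :
  (n%:~R == 0 :> F) = (n == 0).
Proof.
case: n => n; first by move/pcharf0P: charF0 => ->.
by rewrite NegzE mulrNz !oppr_eq0 (negPf (natr_neq0_char0 n)).
Qed.

End CharacteristicZero.

Section Powers.
Variables (F : fieldType) (V : vectType F).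
Implicit Types (x y : 'End(V)) (v : V).

Definition lpow x k : 'End(V) := iter k (fun y => (x \o y)%VF) \1%VF.

Arguments lpow : simpl never.

Lemma lpow0 x v : lpow x 0 v = v. Proof. by rewrite id_lfunE. Qed.

Lemma lpowS x k v : lpow x k.+1 v = x (lpow x k v).
Proof. by rewrite /lpow /= comp_lfunE. Qed.

Lemma lpowD x i j v : lpow x (i + j) v = lpow x i (lpow x j v).
Proof. by elim: i => [|i IHi]; rewrite ?lpow0 // addSn !lpowS IHi. Qed.

Lemma lpowSr x k v : lpow x k.+1 v = lpow x k (x v).
Proof. by rewrite -addn1 lpowD lpowS lpow0. Qed.

Lemma lieE x y v : lie x y v = x (y v) - y (x v).
Proof. by rewrite /lie add_lfunE opp_lfunE !comp_lfunE. Qed.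

Lemma lie_comm x y : lie x y = 0 -> forall v, x (y v) = y (x v).
Proof. by move=> xy0 v; apply/eqP; rewrite -subr_eq0 -lieE xy0 zero_lfunE. Qed.

Lemma lie_subZr x y z c : lie x (y - c *: z) = lie x y - c *: lie x z.
Proof.
apply/lfunP => w; rewrite !(lieE, add_lfunE, opp_lfunE, scale_lfunE).
by rewrite linearB linearZ scalerBr opprD addrACA -opprD.
Qed.

Lemma lie_sumr I (r : seq I) (G : I -> 'End(V)) (c : I -> F) x :
  lie x (\sum_(i <- r) c i *: G i) = \sum_(i <- r) c i *: lie x (G i).
Proof.
apply/lfunP => v; rewrite lieE !sum_lfunE linear_sum -sumrB.
by apply: eq_bigr => i _; rewrite !scale_lfunE lieE linearZ scalerBr.
Qed.

Lemma lpow_comm x y k v :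
  (forall v : V, x (y v) = y (x v)) -> x (lpow y k v) = lpow y k (x v).
Proof. by move=> xy; elim: k => [|k IHk]; rewrite ?lpow0 // !lpowS xy IHk. Qed.

End Powers.

Arguments lpow : simpl never.

(** * Nilpotency, traces and spans *)

Section AdjointNilpotent.
Variables (F : fieldType) (V : vectType F).
Hypothesis charF0 : [pchar F] =i pred0.

Local Notation mx := (mxof (vbasis {:V}) (vbasis {:V})).

(** The powers of x are eigenvectors of ad h for the distinct eigenvalues
    c *+ k, and an operator on a finite-dimensional space has finitely many of
    them. *)
Lemma eigen_ad_nilpotent (h x : 'End(V)) (c : F) :
  c != 0 -> lie h x = c *: x -> exists k, lpow x k = 0.
Proof.
move=> c0 hx.
pose ad (A : 'M[F]_(\dim {:V})) := A *m mx h - mx h *m A.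
have ad_lin : linear ad.
  move=> a A B; rewrite /ad mulmxDl mulmxDr -scalemxAl -scalemxAr.
  by rewrite scalerBr addrACA opprD.
pose adl : {linear 'M[F]_(\dim {:V}) -> 'M[F]_(\dim {:V})} :=
  HB.pack ad (GRing.isLinear.Build _ _ _ _ ad ad_lin).
have hxk k : lie h (lpow x k) = (c *+ k) *: lpow x k.
  elim: k => [|k IHk].
    by rewrite /lie /lpow /= comp_lfun1l comp_lfun1r subrr mulr0n scale0r.
  apply/lfunP => v; rewrite lieE scale_lfunE !lpowS.
  have /lfunP/(_ (lpow x k v)) := hx; rewrite lieE scale_lfunE => /eqP.
  rewrite subr_eq => /eqP ->; have /lfunP/(_ v) := IHk.
  rewrite lieE scale_lfunE => /eqP; rewrite subr_eq => /eqP ->.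
  by rewrite linearD linearZ /= mulrS scalerDl addrA addrK.
pose p := char_poly (lin_mx adl).
have [/forallP nz|/forallPn[k /negPn/eqP k0]] :=
  boolP [forall k : 'I_(size p), lpow x k != 0]; last by exists k.
have root_p k : (k < size p)%N -> root p (c *+ k).
  move=> lt_k; rewrite -eigenvalue_root_char; apply/eigenvalueP.
  exists (mxvec (mx (lpow x k))); last first.
    rewrite mxvec_eq0 mxof_eq0 ?vbasisP //.
    exact: nz (Ordinal lt_k).
  rewrite mul_vec_lin /= -linearZ; congr mxvec; rewrite /ad.
  by rewrite -!mxof_comp ?vbasisP // -linearB -linearZ -hxk.
exfalso.
have p0 : p != 0 by rewrite monic_neq0 ?char_poly_monic.
suff: (size [seq c *+ k | k <- iota 0 (size p)] < size p)%N.
  by rewrite size_map size_iota ltnn.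
apply: (max_poly_roots p0).
- apply/allP => _ /mapP[k lt_k ->]; rewrite mem_iota in lt_k.
  exact: root_p.
- rewrite map_inj_uniq ?iota_uniq // => i j /eqP.
  rewrite -!(mulr_natr c) -subr_eq0 -mulrBr mulf_eq0 (negPf c0) /= subr_eq0.
  by move=> /eqP/(natr_inj_char0 charF0).
Qed.

End AdjointNilpotent.

Section Trace.
Variables (F : fieldType) (V : vectType F).

Definition lfun_trace (x : 'End(V)) : F :=
  \tr (mxof (vbasis {:V}) (vbasis {:V}) x).

Lemma lfun_trace_is_scalar : scalar lfun_trace.
Proof. by move=> a x y; rewrite /lfun_trace !linearP. Qed.

HB.instance Definition _ :=
  GRing.isLinear.Build F 'End(V) F *%R lfun_trace lfun_trace_is_scalar.

Lemma lfun_traceC x y : lfun_trace (x \o y)%VF = lfun_trace (y \o x)%VF.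
Proof.
have b := vbasisP {:V}.
by rewrite /lfun_trace !(mxof_comp _ _ b) mxtrace_mulC.
Qed.

(** Factor P = C R through its rank r: then P P = P forces R C = 1, and the
    trace of C R is that of R C. *)
Lemma mxtrace_idempotent n (P : 'M[F]_n) :
  P *m P = P -> \tr P = (\rank P)%:R.
Proof.
move=> PP; have PE := mulmx_base P.
have [B BC] := row_fullP (col_base_full P).
have [D RD] := row_freeP (row_base_free P).
move: (\rank P) (col_base P) (row_base P) B D PE BC RD => r C R B D PE BC RD.
have : B *m (P *m P) *m D = B *m P *m D by rewrite PP.
subst P; rewrite !mulmxA BC !mul1mx -!mulmxA RD mulmx1 => RC.
by rewrite mxtrace_mulC RC mxtrace1.
Qed.

Lemma lfun_trace_idempotent (charF0 : [pchar F] =i pred0) p :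
  (p \o p)%VF = p -> p != 0 -> lfun_trace p != 0.
Proof.
move=> pp p0; rewrite /lfun_trace mxtrace_idempotent.
  by move/pcharf0P: charF0 => ->; rewrite mxrank_eq0 mxof_eq0 ?vbasisP.
by rewrite -mxof_comp ?pp ?vbasisP.
Qed.

End Trace.

Section Lspan.
Variables (F : fieldType) (V : vectType F).
Implicit Types A B : set 'End(V).

Lemma lspan_mem A x : A x -> lspan A x.
Proof.
move=> Ax; exists [:: x]; last by rewrite memv_span1.
by move=> y; rewrite inE => /eqP->.
Qed.

Lemma lspan0 A : lspan A 0.
Proof. by exists [::]; last exact: mem0v. Qed.

Lemma lspanZ A c x : lspan A x -> lspan A (c *: x).
Proof. by case=> s sA xs; exists s => //; exact: memvZ. Qed.

Lemma lspan_scale_inv A c x :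
  c != 0 -> lspan A (c *: x) -> lspan A x.
Proof. by move=> c0 /(lspanZ c^-1); rewrite scalerA mulVf ?scale1r. Qed.

Lemma lspanD A x y : lspan A x -> lspan A y -> lspan A (x + y).
Proof.
case=> s sA xs [t tA yt]; exists (s ++ t).
  by move=> z; rewrite mem_cat => /orP[/sA|/tA].
by rewrite span_cat memv_add.
Qed.

Lemma lspanB A x y : lspan A x -> lspan A y -> lspan A (x - y).
Proof.
by move=> xA yA; rewrite -scaleN1r; apply: lspanD => //; exact: lspanZ.
Qed.

Lemma lspan_sum (I : eqType) (r : seq I) (G : I -> 'End(V)) A :
  {in r, forall i, lspan A (G i)} -> lspan A (\sum_(i <- r) G i).
Proof.
move=> rA; rewrite big_seq; elim/big_ind: _ => //; first exact: lspan0.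
exact: lspanD.
Qed.

Lemma lspan_subset (P : set 'End(V)) A : P 0 ->
  (forall c x y, P x -> P y -> P (c *: x + y)) -> A `<=` P -> lspan A `<=` P.
Proof.
move=> P0 PD AP x [s sA]; rewrite -[s]in_tupleE => /coord_span ->.
elim/big_rec: _ => // i y _; apply: PD; apply: AP; apply: sA.
by rewrite in_tupleE mem_nth.
Qed.

Lemma lspan_lspan A B : A `<=` lspan B -> lspan A `<=` lspan B.
Proof.
apply: lspan_subset; first exact: lspan0.
by move=> c x y xB yB; apply: lspanD => //; exact: lspanZ.
Qed.

End Lspan.

(** * An obstruction to being a sum of commutators *)

Section Obstruction.
Variables (F : fieldType) (V : vectType F).
Hypothesis charF0 : [pchar F] =i pred0.

(** Here S is a section of e over K. For x commuting with e, the operator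
    x S - S x measures how far x is from preserving S; seen as an endomorphism
    of K it is a derivation in x, so its trace kills commutators, while for
    x = e it is the identity of K. *)
Lemma section_obstruction (e S : 'End(V)) (K : {vspace V}) (A : set 'End(V)) :
  K != 0%VS -> {in K, forall v, e v = 0} -> {in K, forall v, e (S v) = v} ->
  (forall x, A x -> {in K, forall v, x v \in K}) ->
  (forall x, A x -> {in K, forall v, x (S v) - S (x v) \in K}) ->
  ~ lie_prod A A e.
Proof.
move=> K0 eK eS AK ASK; pose pi := projv K.
(* Composing with the projection pi onto K turns endomorphisms of K into
   endomorphisms of V with the same trace. *)
pose D x := (((x \o S)%VF - (S \o x)%VF)%R \o pi)%VF.
have DE x v : D x v = x (S (pi v)) - S (x (pi v)).
  by rewrite comp_lfunE add_lfunE opp_lfunE !comp_lfunE.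
clearbody D.
have pi_id v : v \in K -> pi v = v by exact: projv_id.
have pi_in v : pi v \in K by exact: memv_proj.
have trD_lie x y : A x -> A y -> lfun_trace (D (lie x y)) = 0.
  move=> Ax Ay.
  have DM u w : A u -> A w ->
      D (u \o w)%VF = (u \o D w)%VF + (D u \o (w \o pi))%VF.
    move=> Au Aw; apply/lfunP => v.
    rewrite DE add_lfunE !comp_lfunE !DE linearB.
    rewrite (pi_id (w _)); last by apply: AK.
    by rewrite /= addrA subrK.
  have DB u w : D (u - w) = D u - D w.
    apply/lfunP => v; rewrite !(DE, add_lfunE, opp_lfunE) linearB.
    by rewrite opprD addrACA -opprD.
  have tr_pi u w : A u -> A w ->
      lfun_trace (D u \o (w \o pi))%VF = lfun_trace (w \o D u)%VF.
    move=> Au Aw; rewrite lfun_traceC -comp_lfunA.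
    congr (lfun_trace (_ \o _)%VF); apply/lfunP => v.
    rewrite comp_lfunE pi_id // DE.
    exact: ASK.
  rewrite /lie DB !DM // !linearB !linearD /= !tr_pi //.
  by rewrite [X in _ - X]addrC subrr.
have De : D e = pi.
  apply/lfunP => v; rewrite DE eS // eK // linear0 subr0 //.
move=> e_reach; have : lfun_trace (D e) = 0.
  apply: (lspan_subset (P := [set x | lfun_trace (D x) = 0])) e_reach => /=.
  - have -> : D 0 = 0.
      by apply/lfunP => v; rewrite DE !zero_lfunE linear0 subr0.
    by rewrite linear0.
  - move=> c x y x0 y0; have -> : D (c *: x + y) = c *: D x + D y.
      apply/lfunP => v; rewrite !(DE, add_lfunE, scale_lfunE) linearD linearZ.
      by rewrite opprD addrACA scalerBr.
    by rewrite linearD linearZ /= x0 y0 mulr0 addr0.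
  - by move=> _ [x Ax [y Ay <-]]; exact: trD_lie.
apply/eqP; rewrite De; apply: lfun_trace_idempotent => //.
  by apply/lfunP => v; rewrite comp_lfunE pi_id.
apply: contra K0 => /eqP pi0; rewrite -subv0; apply/subvP => v vK.
by rewrite -(pi_id v vK) pi0 zero_lfunE mem0v.
Qed.

End Obstruction.

(** * Lowest weight vectors of an sl2-triple *)

Section IsometryAlgebra.
Variables (F : fieldType) (V : vectType F).
Variables (e h f : 'End(V)).

(** The index m is minus the weight: for a <> 0 the string of a under e
    consists of the m + 1 vectors a, e a, ..., e^m a. *)
Definition lowest m : {vspace V} := (lker f :&: lker (h + m%:R *: \1%VF)%R)%VS.

Lemma lowestP m a : reflect (f a = 0 /\ h a = - m%:R *: a) (a \in lowest m).
Proof.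
rewrite memv_cap !memv_ker add_lfunE scale_lfunE id_lfunE scaleNr addr_eq0.
by apply: (iffP andP) => -[/eqP-> /eqP->].
Qed.

Hypothesis charF0 : [pchar F] =i pred0.
Hypothesis ehf : sl2_triple e h f.
Hypothesis e_nilp : nilpotent_end e.

Lemma sl2_he v : h (e v) = e (h v) + 2%:R *: e v.
Proof.
have [/lfunP/(_ v)] := ehf; rewrite lieE scale_lfunE => /eqP.
by rewrite subr_eq addrC => /eqP.
Qed.

Lemma sl2_hf v : h (f v) = f (h v) - 2%:R *: f v.
Proof.
have [_ /lfunP/(_ v)] := ehf; rewrite lieE opp_lfunE scale_lfunE => /eqP.
by rewrite subr_eq addrC => /eqP.
Qed.

Lemma sl2_ef v : e (f v) = f (e v) + h v.
Proof.
have [_ _ /lfunP/(_ v)] := ehf; rewrite lieE => /eqP.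
by rewrite subr_eq addrC => /eqP.
Qed.

Lemma sl2_fe v : f (e v) = e (f v) - h v.
Proof. by rewrite sl2_ef addrK. Qed.

Lemma h_lpow k v : h (lpow e k v) = lpow e k (h v) + k.*2%:R *: lpow e k v.
Proof.
elim: k => [|k IHk]; first by rewrite !lpow0 scale0r addr0.
rewrite !lpowS sl2_he IHk linearD linearZ /= -addrA -scalerDl doubleS.
by congr (_ + _ *: _); rewrite !mulrS; ring.
Qed.

Lemma h_lpow_eigen k v c : h v = c *: v ->
  h (lpow e k v) = (c + k.*2%:R) *: lpow e k v.
Proof. by move=> hv; rewrite h_lpow hv linearZ -scalerDl. Qed.

(** The assumption covers both f v = 0, the case of a lowest weight vector, and
    the vectors that f sends to a highest weight vector, as needed for
    lowest_nondeg. *)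
Lemma f_lpow k v : e (f v) = 0 ->
  f (lpow e k.+1 v) = - k.+1%:R *: lpow e k (h v + k%:R *: v).
Proof.
move=> efv; elim: k => [|k IHk].
  by rewrite lpowS !lpow0 sl2_fe efv sub0r scale0r addr0 scaleN1r.
rewrite lpowS sl2_fe IHk linearZ /= -lpowS h_lpow !linearD !linearZ /=.
set X := lpow e k.+1 (h v); set Y := lpow e k.+1 v.
rewrite !scalerA scalerN addrACA -[- X]scaleN1r -scaleNr -!scalerDl.
by congr (_ *: _ + _ *: _); rewrite -?addnn ?natrD !mulrS; ring.
Qed.

Lemma f_lpow_eigen k v c : e (f v) = 0 -> h v = c *: v ->
  f (lpow e k.+1 v) = - (k.+1%:R * (c + k%:R)) *: lpow e k v.
Proof.
by move=> efv hv; rewrite f_lpow // hv -scalerDl linearZ scalerA mulNr.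
Qed.

(** The scalars of f_lpow_eigen are nonzero, so e^(k+1) v = 0 implies
    e^k v = 0. *)
Lemma positive_weight_eq0 m v :
  e (f v) = 0 -> h v = m.+1%:R *: v -> v = 0.
Proof.
have [N eN0] := e_nilp => efv hv.
have : lpow e N v = 0 by rewrite /lpow eN0 zero_lfunE.
elim: N {eN0} => [|N IHN]; first by rewrite lpow0.
move=> eN; apply: IHN; have := f_lpow_eigen N efv hv.
rewrite eN linear0 => /esym/eqP; rewrite scaler_eq0 oppr_eq0 mulf_eq0 -natrD.
by rewrite addSn !(negPf (natr_neq0_char0 charF0 _)) => /eqP.
Qed.

Lemma lpow_lowest m a k : a \in lowest m -> (m < k)%N -> lpow e k a = 0.
Proof.
move=> /lowestP[fa ha] lt_mk; rewrite -(subnK lt_mk) lpowD.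
suff -> : lpow e m.+1 a = 0 by rewrite linear0.
apply: (@positive_weight_eq0 m.+1).
  rewrite (f_lpow_eigen _ _ ha) ?fa ?linear0 // addNr mulr0 oppr0.
  by rewrite scale0r linear0.
rewrite (h_lpow_eigen _ ha) -addnn; congr (_ *: _).
by rewrite !natrD !mulrS; ring.
Qed.

Lemma lpow_lowest_inj m a k :
  a \in lowest m -> (k <= m)%N -> lpow e k a = 0 -> a = 0.
Proof.
move=> /lowestP[fa ha]; elim: k => [|k IHk] le_km; first by rewrite lpow0.
move=> ek; apply: IHk; first exact: ltnW.
have efa : e (f a) = 0 by rewrite fa linear0.
have := f_lpow_eigen k efa ha.
rewrite ek linear0 => /esym/eqP; rewrite scaler_eq0 oppr_eq0 mulf_eq0.
rewrite (negPf (natr_neq0_char0 charF0 _)) /= addrC subr_eq0.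
case: (_ =P m%:R) => [/(natr_inj_char0 charF0) km|_ /eqP//].
by rewrite km ltnn in le_km.
Qed.

(** By f_lpow, e^(n+1) v = 0 implies that e^n kills (h + n) v. By induction on
    the nilpotency order, (h + n) v is a sum of vectors of weights 0, ...,
    -(n-1), on which h + n is invertible; subtracting the preimage of that sum
    from v leaves a vector of weight -n. Thus h is diagonalisable on ker f,
    with weights <= 0. *)
Lemma lowest_decomp v : f v = 0 ->
  exists n, exists2 w : nat -> V, forall j, w j \in lowest j &
    v = \sum_(j < n) w j.
Proof.
move=> fv; have [N eN0] := e_nilp; exists N.
have : lpow e N v = 0 by rewrite /lpow eN0 zero_lfunE.
elim: N v fv {eN0} => [|n IHn] v fv env.
  exists (fun=> 0) => [j|]; first exact: mem0v.
  by rewrite big_ord0 -[v](lpow0 e).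
pose v' := h v + n%:R *: v.
have fv' : f v' = 0.
  have := sl2_hf v; rewrite fv scaler0 subr0 linear0 => /esym fh.
  by rewrite linearD linearZ /= fh fv scaler0 addr0.
have env' : lpow e n v' = 0.
  have efv : e (f v) = 0 by rewrite fv linear0.
  have /esym/eqP := f_lpow n efv; rewrite env linear0 scaler_eq0 oppr_eq0.
  by rewrite (negPf (natr_neq0_char0 charF0 _)) => /eqP.
have [w w_low v'E] := IHn _ fv' env'.
have nj (j : 'I_n) : (n%:R - j%:R : F) != 0.
  rewrite -natrB 1?ltnW // -[(n - j)%N]prednK ?subn_gt0 //.
  exact: natr_neq0_char0.
pose z := \sum_(j < n) (n%:R - j%:R)^-1 *: w j.
have fz : f z = 0.
  rewrite linear_sum big1 // => j _; rewrite linearZ /=.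
  by have /lowestP[-> _] := w_low j; rewrite scaler0.
have hz : h z + n%:R *: z = v'.
  rewrite v'E linear_sum scaler_sumr -big_split; apply: eq_bigr => j _ /=.
  have /lowestP[_ hw] := w_low j.
  rewrite linearZ /= hw !scalerA -scalerDl mulrC -mulrDl addrC mulfV //.
  by rewrite scale1r.
exists (fun j => if (j < n)%N then (n%:R - j%:R)^-1 *: w j else
                 if j == n then v - z else 0) => [j|].
  case: ltnP => [lt_jn|_]; first exact: memvZ.
  case: eqP => [->|_]; last exact: mem0v.
  apply/lowestP; split; first by rewrite linearB /= fv fz subr0.
  apply/eqP; rewrite scaleNr -addr_eq0 linearB /= scalerBr addrACA -opprD hz.
  by rewrite subrr.
rewrite big_ord_recr /= ltnn eqxx; under eq_bigr do rewrite ltn_ord.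
by rewrite addrC subrK.
Qed.

(** * The bilinear form *)

Variables (eps : bool) (phi : {hermitian V for eps & idfun}).

Lemma phiC u v : phi u v = (-1) ^+ eps * phi v u.
Proof. by rewrite [LHS]hermitian_subproof. Qed.

Lemma phiZl c u v : phi (c *: u) v = c * phi u v.
Proof. exact: linearZl_LR. Qed.

Lemma phiZr c u v : phi u (c *: v) = c * phi u v.
Proof. exact: linearZr_LR. Qed.

Lemma phiDl u v w : phi (u + v) w = phi u w + phi v w.
Proof. exact: linearDl. Qed.

Lemma phiDr u v w : phi w (u + v) = phi w u + phi w v.
Proof. exact: linearDr. Qed.

Lemma phiNl u v : phi (- u) v = - phi u v.
Proof. exact: linearNl. Qed.

Lemma phiNr u v : phi u (- v) = - phi u v.
Proof. exact: linearNr. Qed.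

Lemma phi0l u : phi 0 u = 0. Proof. exact: linear0l. Qed.

Lemma phi0r u : phi u 0 = 0. Proof. exact: linear0r. Qed.

Lemma phi_suml I (r : seq I) (P : pred I) (G : I -> V) v :
  phi (\sum_(i <- r | P i) G i) v = \sum_(i <- r | P i) phi (G i) v.
Proof. exact: linear_sumlz. Qed.

Lemma phi_sumr I (r : seq I) (P : pred I) (G : I -> V) v :
  phi v (\sum_(i <- r | P i) G i) = \sum_(i <- r | P i) phi v (G i).
Proof. exact: linear_sumr. Qed.

Definition rank1_fun u v (w : V) : V := phi w u *: v.

Lemma rank1_is_linear u v : linear (rank1_fun u v).
Proof.
by move=> c x y; rewrite /rank1_fun phiDl phiZl scalerDl scalerA.
Qed.

HB.instance Definition _ u v :=
  GRing.isLinear.Build F V V _ (rank1_fun u v) (rank1_is_linear u v).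

Definition rank1 u v : 'End(V) := linfun (rank1_fun u v).

Lemma rank1E u v w : rank1 u v w = phi w u *: v.
Proof. by rewrite lfunE. Qed.

(** Applied with g = e^m on M_m, where phi(e^m a, b) is the form induced by
    phi on the multiplicity space, and with g = 1 on V. *)
Lemma dual_bases (U : {vspace V}) (g : 'End(V)) :
  (forall u, u \in U -> (forall b, b \in U -> phi (g u) b = 0) -> u = 0) ->
  exists2 s : seq (V * V), {in s, forall p, p.1 \in U /\ p.2 \in U} &
    forall u, u \in U -> u = \sum_(p <- s) phi (g u) p.1 *: p.2.
Proof.
move=> nondeg; set n := \dim U; pose X := vbasis U.
have X_in (i : 'I_n) : X`_i \in U by rewrite vbasis_mem ?mem_nth ?size_tuple.
pose G := \matrix_(i < n, j < n) phi (g X`_i) X`_j.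
have Gcomb (r : 'rV[F]_n) (j : 'I_n) :
    phi (g (\sum_i r 0 i *: X`_i)) X`_j = (r *m G) 0 j.
  rewrite linear_sum phi_suml mxE; apply: eq_bigr => i _ /=.
  by rewrite mxE linearZ phiZl.
have Gunit : G \in unitmx.
  rewrite -row_free_unit -kermx_eq0; apply/rowV0P => r /sub_kermxP rG0.
  have u0 : \sum_i r 0 i *: X`_i = 0.
    apply: nondeg => [|b bU]; first by apply: memv_suml => i _; exact: memvZ.
    rewrite (coord_vbasis bU) phi_sumr big1 // => j _ /=.
    by rewrite phiZr Gcomb rG0 mxE mulr0.
  have /freeP/(_ _ u0) r0 := basis_free (vbasisP U).
  by apply/rowP => i; rewrite r0 mxE.
pose b i := \sum_(j < n) invmx G j i *: X`_j.
exists [seq (b i, X`_i) | i <- enum 'I_n].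
  move=> _ /mapP[i _ ->]; split; last exact: X_in.
  by apply: memv_suml => j _; exact: memvZ.
move=> u uU; rewrite big_map big_enum /= {1}(coord_vbasis uU).
apply: eq_bigr => i _; congr (_ *: _).
pose c := \row_j coord X j u.
have -> : u = \sum_j c 0 j *: X`_j.
  by rewrite {1}(coord_vbasis uU); apply: eq_bigr => j _; rewrite mxE.
transitivity ((c *m G *m invmx G) 0 i).
  rewrite mulmxK // mxE; congr (coord _ _ _).
  by rewrite {1}(coord_vbasis uU); apply: eq_bigr => j _; rewrite mxE.
rewrite phi_sumr mxE; apply: eq_bigr => j _ /=.
by rewrite phiZr Gcomb mulrC.
Qed.

Hypothesis phi_nondeg : nondegenerate phi.

Lemma phi_injl u : (forall v, phi u v = 0) -> u = 0.
Proof.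
move=> u0; apply/eqP; rewrite -memv0 -(eqP phi_nondeg).
by apply/mem_orthovP => v _.
Qed.

Lemma phi_injr u : (forall v, phi v u = 0) -> u = 0.
Proof. by move=> u0; apply: phi_injl => v; rewrite phiC u0 mulr0. Qed.

Lemma adjoint_exists (g : 'End(V)) y :
  exists z, forall x, phi (g x) y = phi x z.
Proof.
have [|s _ sE] := @dual_bases fullv \1%VF.
  move=> u _; rewrite id_lfunE => u0; apply: phi_injl => v.
  by rewrite u0 ?memvf.
exists (\sum_(p <- s) phi (g p.2) y *: p.1) => x.
rewrite {1}(sE x (memvf x)) linear_sum phi_suml phi_sumr.
by apply: eq_bigr => p _ /=; rewrite linearZ phiZl phiZr id_lfunE mulrC.
Qed.

Lemma isometry_lieNl x : isometry_lie phi x ->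
  forall u v, phi (x u) v = - phi u (x v).
Proof. by move=> gx u v; apply/eqP; rewrite -addr_eq0 gx. Qed.

Lemma phi_lpow x k : isometry_lie phi x ->
  forall u v, phi (lpow x k u) v = (-1) ^+ k * phi u (lpow x k v).
Proof.
move=> gx; elim: k => [|k IHk] u v; first by rewrite !lpow0 mul1r.
by rewrite lpowSr IHk isometry_lieNl // -lpowS exprS mulN1r mulNr mulrN.
Qed.

(** The image of x is the orthogonal of its kernel because x is skew. If q
    projects onto im x, the adjoint of 1 - q takes its values in ker x, so
    v - q v is orthogonal to everything. *)
Lemma ortho_ker_img x v : isometry_lie phi x ->
  (forall z, x z = 0 -> phi v z = 0) -> exists u, v = x u.
Proof.
move=> gx v_ker; pose q := projv (limg x).
suff vq : v = q v.
  have : v \in limg x by rewrite vq memv_proj.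
  by case/memv_imgP => u _ ->; exists u.
apply/eqP; rewrite -subr_eq0; apply/eqP/phi_injl => y.
have [z zE] := adjoint_exists (\1%VF - q) y.
have := zE v; rewrite add_lfunE opp_lfunE id_lfunE => ->; apply: v_ker.
apply: phi_injr => u; apply/eqP; rewrite -oppr_eq0 -isometry_lieNl //.
rewrite -zE add_lfunE opp_lfunE id_lfunE projv_id ?memv_img ?memvf //.
by rewrite subrr phi0l.
Qed.

Lemma weight_ortho x u v c d : isometry_lie phi x ->
  x u = c *: u -> x v = d *: v -> c + d != 0 -> phi u v = 0.
Proof.
move=> gx xu xv; have := gx u v; rewrite xu xv phiZl phiZr -mulrDl => /eqP.
by rewrite mulf_eq0 => /orP[->|/eqP].
Qed.

(** * Decomposition of V into strings *)

Hypotheses (ge : isometry_lie phi e) (gh : isometry_lie phi h).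
Hypothesis gf : isometry_lie phi f.

Local Notation M := lowest.
Local Notation g := (isometry_lie phi).

(** Weights force 2k = m + m', while e^k kills a when k > m and b when k > m';
    so only k = m = m' remains. *)
Lemma phi_lowest m m' k a b : a \in M m -> b \in M m' ->
  ~~ ((m == m') && (k == m)) -> phi (lpow e k a) b = 0.
Proof.
move=> aM bM ne.
have [lt_mk|le_km] := ltnP m k.
  by rewrite (lpow_lowest aM lt_mk) phi0l.
have [lt_mk|le_km'] := ltnP m' k.
  by rewrite phi_lpow // (lpow_lowest bM lt_mk) phi0r mulr0.
have /lowestP[_ ha] := aM; have /lowestP[_ hb] := bM.
apply: (weight_ortho gh (h_lpow_eigen k ha) hb).
rewrite addrAC -opprD addrC -natrD subr_eq0; apply/negP => /eqP.
move/(natr_inj_char0 charF0); lia.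
Qed.

(** If b = e^m a is orthogonal to M_m then, by weights, it is orthogonal to
    ker f, so b = f u. Correcting u by an element of ker f makes it a vector
    of weight m + 2 with e (f u) = 0, hence u = 0. *)
Lemma lowest_nondeg m a : a \in M m ->
  (forall b, b \in M m -> phi (lpow e m a) b = 0) -> a = 0.
Proof.
move=> aM a_ortho; apply: (lpow_lowest_inj aM (leqnn m)).
have /lowestP[fa ha] := aM.
set b := lpow e m a.
have eb : e b = 0.
  by rewrite -lpowS (lpow_lowest aM).
have hb : h b = m%:R *: b.
  by rewrite (h_lpow_eigen m ha) -addnn natrD addrA addNr add0r.
have [z fz0|u bE] := ortho_ker_img (v := b) gf.
  have [n [w wM ->]] := lowest_decomp fz0.
  rewrite phi_sumr big1 // => j _; have [jm|ne] := eqVneq (j : nat) m.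
    by apply: a_ortho; rewrite -jm.
  by apply: (phi_lowest aM (wM j)); rewrite eq_sym (negPf ne).
have fy : f (h u - m.+2%:R *: u) = 0.
  have := sl2_hf u; rewrite -bE hb => /eqP; rewrite eq_sym subr_eq => /eqP.
  move=> fh; rewrite linearB linearZ /= fh -bE -scalerDl -scalerBl.
  by rewrite -natrD -natrB ?addn2 // subnn scale0r.
have [n [w wM yE]] := lowest_decomp fy.
(* On M_j the operator h - (m + 2) is the scalar - (j + m + 2), so z solves
   (h - (m + 2)) z = (h - (m + 2)) u in ker f. *)
pose z := \sum_(j < n) - (j + m.+2)%:R^-1 *: w j.
have fz : f z = 0.
  rewrite linear_sum big1 // => j _; rewrite linearZ /=.
  by have /lowestP[-> _] := wM j; rewrite scaler0.
have hz : h z - m.+2%:R *: z = h u - m.+2%:R *: u.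
  rewrite yE linear_sum scaler_sumr -sumrB; apply: eq_bigr => j _ /=.
  have /lowestP[_ hw] := wM j.
  rewrite linearZ /= hw !scalerA -scalerBl mulrC -mulrBl -opprD -natrD mulrNN.
  by rewrite mulfV ?scale1r // addnS (natr_neq0_char0 charF0).
have bE' : b = f (u - z) by rewrite linearB /= fz subr0.
have u0 : u - z = 0.
  apply: (positive_weight_eq0 (m := m.+1)).
    by rewrite -bE'.
  apply/eqP; rewrite -subr_eq0 linearB scalerBr opprD addrACA -opprD /= hz.
  by rewrite subrr.
by rewrite bE' u0 linear0.
Qed.

Lemma lowest_dual n p : p \in M n -> p != 0 ->
  exists2 q, q \in M n & phi (lpow e n p) q != 0.
Proof.
move=> pM p0; apply: contrapT => nex; case/eqP: p0.
apply: (lowest_nondeg pM) => q qM.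
by apply/eqP/negPn/negP => ne; apply: nex; exists q.
Qed.

(** The strings span V: their common orthogonal is stable under the nilpotent
    f, and by lowest_nondeg it meets ker f in 0. *)
Lemma ortho_lowest_eq0 v :
  (forall m a j, a \in M m -> phi (lpow e j a) v = 0) -> v = 0.
Proof.
have f_nilp : exists k, lpow f k = 0.
  have [_ hf _] := ehf; rewrite -scaleNr in hf.
  apply: (eigen_ad_nilpotent charF0 _ hf).
  by rewrite oppr_eq0 (natr_neq0_char0 charF0).
have [K fK] := f_nilp; have : lpow f K v = 0 by rewrite fK zero_lfunE.
elim: K v {fK} => [|K IHK] v fKv v_ortho; first by rewrite -[v](lpow0 f).
have fv : f v = 0.
  apply: IHK => [|m a j aM]; first by rewrite -lpowSr.
  have /lowestP[fa ha] := aM.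
  apply/eqP; rewrite -oppr_eq0 -isometry_lieNl //; apply/eqP.
  case: j => [|j]; first by rewrite lpow0 fa phi0l.
  rewrite (f_lpow_eigen j _ ha) ?fa ?linear0 // phiZl.
  by rewrite (v_ortho m) // mulr0.
have [n [w wM vE]] := lowest_decomp fv.
rewrite vE big1 // => i _; apply: (lowest_nondeg (wM i)) => b bM.
rewrite phi_lpow // phiC.
have := v_ortho i b i bM; rewrite {1}vE phi_sumr (bigD1 i) //= big1 ?addr0.
  by move=> ->; rewrite !mulr0.
by move=> j ne; apply: (phi_lowest bM (wM j)); rewrite eqxx andbT eq_sym.
Qed.

(** For u and v in M_N this operator commutes with e: it sends e^j a to
    phi(e^N a, u) e^j v when a is in M_N, and kills the strings of the
    other M_m. *)
Definition string_op N u v : 'End(V) :=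
  \sum_(k < N.+1) (-1) ^+ k *: rank1 (lpow e k u) (lpow e (N - k) v).

Lemma string_opE N u v w : string_op N u v w =
  \sum_(k < N.+1) ((-1) ^+ k * phi w (lpow e k u)) *: lpow e (N - k) v.
Proof.
rewrite sum_lfunE; apply: eq_bigr => k _.
by rewrite scale_lfunE rank1E scalerA.
Qed.

Lemma string_op_lowest N n m j p v a : p \in M n -> a \in M m ->
  (n <= N)%N -> (j <= m)%N ->
  string_op N p v (lpow e j a) =
  if m == n then phi (lpow e n a) p *: lpow e (N - (n - j)) v else 0.
Proof.
move=> pM aM le_nN le_jm; rewrite string_opE.
have term k : (-1) ^+ k * phi (lpow e j a) (lpow e k p) =
    phi (lpow e (k + j) a) p.
  by rewrite lpowD [in RHS]phi_lpow.
under eq_bigr do rewrite term.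
have [emn|ne] := eqVneq m n; last first.
  by rewrite big1 // => k _; rewrite (phi_lowest aM pM) ?scale0r // (negPf ne).
rewrite emn in le_jm *; have lt_nj : (n - j < N.+1)%N by lia.
rewrite (bigD1 (Ordinal lt_nj)) //= big1 ?addr0 => [|k]; first by rewrite subnK.
by rewrite -val_eqE /= => ne; rewrite (phi_lowest aM pM) ?scale0r //; lia.
Qed.

(** The entry (m, (b, a)) of the list stands for a pair of dual basis vectors
    of M_m for the pairing phi(e^m -, -). *)
Lemma resolution_of_identity :
  exists2 t : seq (nat * (V * V)),
    {in t, forall p, p.2.1 \in M p.1 /\ p.2.2 \in M p.1} &
    forall v, v = \sum_(p <- t) string_op p.1 p.2.1 p.2.2 v.
Proof.
have [N eN0] := e_nilp.
have [t tM tE] : exists2 t : seq (nat * (V * V)),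
    {in t, forall p, p.2.1 \in M p.1 /\ p.2.2 \in M p.1} &
    forall m a, (m < N)%N -> a \in M m ->
      a = \sum_(p <- t) if m == p.1 then phi (lpow e m a) p.2.1 *: p.2.2 else 0.
  elim: N {eN0} => [|N [t tM tE]]; first by exists [::].
  have [u uM u0|s sM sE] := @dual_bases (M N) (lpow e N).
    exact: lowest_nondeg uM u0.
  exists ([seq (N, p) | p <- s] ++ [seq p <- t | p.1 != N]).
    move=> p; rewrite mem_cat mem_filter => /orP[/mapP[q qs ->]|/andP[_]] /=.
      exact: sM.
    exact: tM.
  move=> m a; rewrite ltnS leq_eqVlt big_cat big_map big_filter /=.
  have [-> _ aM|neq /= lt_mN aM] := eqVneq m N.
    rewrite [X in _ + X]big1 ?addr0 => [|p]; last by rewrite eq_sym => /negPf->.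
    exact: sE.
  rewrite big1_eq add0r.
  rewrite {1}(tE m a lt_mN aM) [RHS]big_mkcond; apply: eq_bigr => p _.
  by case: ifP => [/eqP <-|_]; [rewrite neq|case: ifP].
exists t => // v; apply/eqP; rewrite -subr_eq0; apply/eqP.
apply: phi_injl => w.
pose P : 'End(V) := \sum_(p <- t) string_op p.1 p.2.1 p.2.2.
(* P fixes every e^j a, so w - z is orthogonal to all of them and hence 0. *)
have [z zE] := adjoint_exists P w.
suff wz : w = z.
  by rewrite phiDl phiNl -sum_lfunE -/P zE wz subrr.
apply/eqP; rewrite -subr_eq0; apply/eqP; apply: ortho_lowest_eq0 => m a j aM.
rewrite phiDr phiNr -zE; suff -> : P (lpow e j a) = lpow e j a by rewrite subrr.
have [le_jm|lt_mj] := leqP j m; last by rewrite (lpow_lowest aM) ?linear0.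
have a0 : a = \sum_(p <- t)
    if m == p.1 then phi (lpow e m a) p.2.1 *: p.2.2 else 0.
  have [lt_mN|le_Nm] := ltnP m N; first exact: tE.
  have -> : a = 0.
    apply: (lpow_lowest_inj aM le_Nm).
    by rewrite /lpow eN0 zero_lfunE.
  by rewrite big1 // => p _; rewrite linear0 phi0l scale0r if_same.
rewrite sum_lfunE {2}a0 linear_sum; apply: eq_big_seq => p pt /=.
have [p1M p2M] := tM p pt; rewrite (string_op_lowest _ p1M aM) //.
by case: eqP => [<-|_]; rewrite ?subKn // ?linearZ ?linear0.
Qed.

(** * Highest weight vectors of the isometry algebra *)

(** The sign relating string_op N u v to the adjoint of string_op N v u. *)
Local Notation sg N := ((-1) ^+ eps * (-1) ^+ N).

Lemma sg_sqr N : sg N * sg N = 1 :> F.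
Proof. by rewrite mulrACA -!expr2 !sqrr_sign mulr1. Qed.

Lemma sg_neq0 N : sg N != 0 :> F.
Proof. by rewrite mulf_neq0 ?signr_eq0. Qed.

Lemma rank1_linr u c v w : rank1 u (c *: v + w) = c *: rank1 u v + rank1 u w.
Proof.
apply/lfunP => x; rewrite add_lfunE scale_lfunE !rank1E scalerDr !scalerA.
by rewrite mulrC.
Qed.

Lemma rank1_linl u c v w : rank1 (c *: v + w) u = c *: rank1 v u + rank1 w u.
Proof.
apply/lfunP => x; rewrite add_lfunE scale_lfunE !rank1E phiDr phiZr.
by rewrite scalerDl scalerA.
Qed.

Lemma rank10l u : rank1 0 u = 0.
Proof. by apply/lfunP => x; rewrite rank1E phi0r scale0r zero_lfunE. Qed.

Lemma rank10r u : rank1 u 0 = 0.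
Proof. by apply/lfunP => x; rewrite rank1E scaler0 zero_lfunE. Qed.

Lemma string_op_linr N u c v w :
  string_op N u (c *: v + w) = c *: string_op N u v + string_op N u w.
Proof.
rewrite scaler_sumr -big_split; apply: eq_bigr => k _ /=.
by rewrite linearD linearZ /= rank1_linr scalerDr !scalerA mulrC.
Qed.

Lemma string_op_linl N u c v w :
  string_op N (c *: v + w) u = c *: string_op N v u + string_op N w u.
Proof.
rewrite scaler_sumr -big_split; apply: eq_bigr => k _ /=.
by rewrite linearD linearZ /= rank1_linl scalerDr !scalerA mulrC.
Qed.

Lemma string_op_adjoint N u v w w' :
  phi (string_op N u v w) w' = sg N * phi w (string_op N v u w').
Proof.
rewrite !string_opE phi_suml phi_sumr mulr_sumr (reindex_inj rev_ord_inj) /=.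
apply: eq_bigr => k _; have le_kN : (k <= N)%N by rewrite -ltnS.
rewrite phiZl phiZr subSS subKn // [phi w' _]phiC.
have -> : (-1) ^+ N = (-1) ^+ (N - k) * (-1) ^+ k :> F by rewrite -exprD subnK.
have s2 : (-1) ^+ eps * (-1) ^+ eps = 1 :> F by rewrite -expr2 sqrr_sign.
have t2 : (-1) ^+ k * (-1) ^+ k = 1 :> F by rewrite -expr2 sqrr_sign.
set A := phi w _; set B := phi _ w'.
transitivity ((-1) ^+ eps * (-1) ^+ eps * ((-1) ^+ k * (-1) ^+ k) *
  ((-1) ^+ (N - k) * A * B)); last by ring.
by rewrite s2 t2 !mul1r.
Qed.

(** Moving e from one argument to the other shifts the alternating sum by one
    index and changes it by a boundary term; the two boundary terms of
    string_op_er and string_op_el are the ones left when ad e telescopes. *)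
Lemma string_op_er N u v :
  string_op N u (e v) =
    string_op N.+1 u v - (-1) ^+ N.+1 *: rank1 (lpow e N.+1 u) v.
Proof.
rewrite [string_op N.+1 u v]big_ord_recr /= subnn lpow0 addrK.
by apply: eq_bigr => k _; rewrite -lpowSr subSn // -ltnS.
Qed.

Lemma string_op_el N u v :
  string_op N (e u) v = rank1 u (lpow e N.+1 v) - string_op N.+1 u v.
Proof.
rewrite [string_op N.+1 u v]big_ord_recl /= expr0 scale1r lpow0 subn0.
rewrite opprD addNKr -sumrN; apply: eq_bigr => k _.
by rewrite -lpowSr subSS exprS mulN1r scaleNr opprK.
Qed.

Lemma lie_rank1 x u v : isometry_lie phi x ->
  lie x (rank1 u v) = rank1 (x u) v + rank1 u (x v).
Proof.
move=> gx; apply/lfunP => w; rewrite lieE add_lfunE !rank1E linearZ /=.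
by rewrite isometry_lieNl // scaleNr opprK addrC.
Qed.

Lemma lie_string_op x N u v : isometry_lie phi x -> lie x e = 0 ->
  lie x (string_op N u v) = string_op N (x u) v + string_op N u (x v).
Proof.
move=> gx /lie_comm xe; rewrite lie_sumr -big_split; apply: eq_bigr => k _ /=.
by rewrite lie_rank1 // scalerDr !lpow_comm.
Qed.

(** Reversing the second sum shows that this is the element
    sum_(k <= N) (-1)^k (e^k u).(e^(N-k) v) of g. *)
Definition highest_op N u v : 'End(V) :=
  string_op N u v - sg N *: string_op N v u.

Lemma highest_op_sym N u v : highest_op N v u = - (sg N *: highest_op N u v).
Proof. by rewrite /highest_op scalerBr scalerA sg_sqr scale1r opprB. Qed.

Lemma highest_op_is_linear N u : linear (highest_op N u).
Proof.
move=> c v w; rewrite /highest_op string_op_linr string_op_linl scalerBr.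
by rewrite scalerDr opprD addrACA !scalerA mulrC.
Qed.

HB.instance Definition _ N u :=
  GRing.isLinear.Build F V 'End(V) _ (highest_op N u)
    (highest_op_is_linear N u).

Lemma highest_op_isometry N u v : isometry_lie phi (highest_op N u v).
Proof.
move=> w w'; rewrite /highest_op !add_lfunE !opp_lfunE !scale_lfunE.
rewrite phiDl phiDr phiNl phiNr phiZl phiZr !string_op_adjoint.
by rewrite mulrA sg_sqr mul1r addrC addrA subrK subrr.
Qed.

Lemma lie_highest_op x N u v : isometry_lie phi x -> lie x e = 0 ->
  lie x (highest_op N u v) = highest_op N (x u) v + highest_op N u (x v).
Proof.
move=> gx xe; rewrite /highest_op lie_subZr !lie_string_op //.
by rewrite [string_op N (x v) u + _]addrC scalerDr opprD addrACA.
Qed.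

Lemma highest_op_er N u v :
  lpow e N.+1 u = 0 -> highest_op N u (e v) = highest_op N.+1 u v.
Proof.
move=> eu; rewrite /highest_op string_op_er string_op_el eu rank10l rank10r.
by rewrite scaler0 subr0 sub0r exprS mulrCA mulN1r scaleNr scalerN.
Qed.

Lemma highest_op_lpow N k u v :
  lpow e N.+1 u = 0 -> highest_op N u (lpow e k v) = highest_op (N + k) u v.
Proof.
elim: k N => [|k IHk] N eu; first by rewrite lpow0 addn0.
rewrite lpowS highest_op_er // IHk ?addnS //.
by rewrite lpowS eu linear0.
Qed.

Lemma lie_e_highest_op N u v :
  lpow e N.+1 u = 0 -> lpow e N.+1 v = 0 -> lie e (highest_op N u v) = 0.
Proof.
move=> eu ev; rewrite lie_highest_op //; last by rewrite /lie subrr.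
rewrite highest_op_er // [highest_op N (e u) v]highest_op_sym highest_op_er //.
rewrite [highest_op N.+1 v u]highest_op_sym scalerN opprK scalerA exprS !mulN1r.
by rewrite !mulrN sg_sqr scaleN1r addNr.
Qed.

Lemma lie_h_string_op N m m' a b : a \in M m -> b \in M m' ->
  lie h (string_op N a b) = (N.*2%:Z - m%:Z - m'%:Z)%:~R *: string_op N a b.
Proof.
move=> aM bM; have /lowestP[_ ha] := aM; have /lowestP[_ hb] := bM.
rewrite lie_sumr scaler_sumr; apply: eq_bigr => k _.
rewrite lie_rank1 // (h_lpow_eigen _ ha) (h_lpow_eigen _ hb).
apply/lfunP => w; rewrite !scale_lfunE add_lfunE !rank1E phiZr.
rewrite !scalerA -scalerDl !scalerA; congr (_ *: _).
have le_kN : (k <= N)%N by rewrite -ltnS.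
have -> : N.*2 = (k.*2 + (N - k).*2)%N by lia.
by rewrite !intrB -!pmulrn natrD; ring.
Qed.

Lemma highest_op_weight N m m' a b l :
  a \in M m -> b \in M m' -> (m <= N)%N -> (m' <= N)%N ->
  N.*2%:Z = l + m%:Z + m'%:Z -> weight_centraliser g e h l (highest_op N a b).
Proof.
move=> aM bM le_mN le_m'N Nl; split; last first.
  split; first exact: highest_op_isometry.
  have eC : lie e (highest_op N a b) = 0.
    apply: lie_e_highest_op => //.
      exact: (lpow_lowest aM).
    exact: (lpow_lowest bM).
  by apply/lfunP => v; rewrite lieE (lie_comm eC) subrr zero_lfunE.
split; first exact: highest_op_isometry.
have lE : l = N.*2%:Z - m%:Z - m'%:Z by rewrite Nl; ring.
have lE' : l = N.*2%:Z - m'%:Z - m%:Z by rewrite Nl; ring.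
rewrite /highest_op lie_subZr (lie_h_string_op N aM bM).
by rewrite (lie_h_string_op N bM aM) -lE -lE' scalerBr !scalerA mulrC.
Qed.

(** The bounds on N make e^(N+1) vanish on a and b, which is what
    highest_op N a b needs to commute with e. *)
Definition highest_ops (l : int) : set 'End(V) :=
  [set x | exists N m m' a b, [/\ a \in M m /\ b \in M m', (m <= N)%N,
     (m' <= N)%N, N.*2%:Z = l + m%:Z + m'%:Z & x = highest_op N a b]].

(** Composing x with the resolution of the identity gives x = sum
    string_op m b (x a); as x is skew, adding the opposite of the adjoint
    gives 2 x = sum highest_op m b (x a). Expanding x a along the strings by
    the same resolution leaves terms e^(m'-k) a', whose powers of e are
    absorbed in the index of highest_op; a nonzero coefficient forces the
    weight and the bounds. *)
Lemma weight_centraliser_span l x :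
  weight_centraliser g e h l x -> lspan (highest_ops l) x.
Proof.
case=> -[gx hx] [_ /lie_comm xe].
have [t tM tE] := resolution_of_identity.
have xs v : x v = \sum_(p <- t) string_op p.1 p.2.1 (x p.2.2) v.
  rewrite {1}(tE v) linear_sum; apply: eq_bigr => p _ /=.
  rewrite !string_opE linear_sum; apply: eq_bigr => k _.
  by rewrite linearZ /= lpow_comm.
have xs' v : x v = - \sum_(p <- t) ((-1) ^+ eps * (-1) ^+ p.1) *:
    string_op p.1 (x p.2.2) p.2.1 v.
  apply/eqP; rewrite -subr_eq0 opprK; apply/eqP/phi_injr => u.
  rewrite phiDr -[phi u (x v)]opprK -isometry_lieNl // xs phi_suml.
  rewrite phi_sumr -sumrN -big_split big1 // => p _ /=.
  by rewrite phiZr string_op_adjoint // addNr.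
have x2 : 2%:R *: x = \sum_(p <- t) highest_op p.1 p.2.1 (x p.2.2).
  apply/lfunP => v; rewrite scale_lfunE sum_lfunE scaler_nat mulr2n.
  rewrite {1}xs xs' -sumrB; apply: eq_bigr => p _.
  by rewrite /highest_op add_lfunE opp_lfunE scale_lfunE.
have -> : x = 2%:R^-1 *: (2%:R *: x).
  by rewrite scalerA mulVf ?scale1r // (natr_neq0_char0 charF0).
rewrite x2; apply/lspanZ/lspan_sum => -[m [b a]] /tM [/= bM aM].
rewrite [x a]tE linear_sum; apply: lspan_sum => -[m' [b' a']] /tM[/= bM' aM'].
rewrite string_opE linear_sum -big_enum; apply: lspan_sum => k _ /=.
rewrite linearZ /=.
have [-> |ne0] := eqVneq (phi (x a) (lpow e k b')) 0.
  by rewrite mulr0 scale0r; exact: lspan0.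
(* e^(m+1) a = 0, so x a is orthogonal to the image of e^(m+1). *)
have le_km : (k <= m)%N.
  rewrite leqNgt; apply/negP => lt_mk; move/eqP: ne0; apply.
  have := phi_lpow k ge (x a) b'; rewrite -lpow_comm //.
  rewrite (lpow_lowest aM lt_mk) linear0 phi0l => /esym/eqP.
  by rewrite mulf_eq0 signr_eq0 => /eqP.
have le_km' : (k <= m')%N by rewrite -ltnS.
have /lowestP[_ ha] := aM; have /lowestP[_ hb'] := bM'.
have hxa : h (x a) = (l - m%:Z)%:~R *: x a.
  have /lfunP/(_ a) := hx; rewrite lieE scale_lfunE ha linearZ /= => /eqP.
  by rewrite subr_eq -scalerDl intrB -pmulrn => /eqP.
have wt : l - m%:Z + k.*2%:Z - m'%:Z = 0.
  apply/eqP; rewrite -(intr_eq0_char0 charF0); apply/negPn/negP => wt.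
  move/eqP: ne0; apply.
  apply: (weight_ortho gh hxa (h_lpow_eigen k hb')).
  move: wt; apply: contra => /eqP; rewrite !(intrB, intrD) -!pmulrn => <-.
  by apply/eqP; ring.
apply/lspanZ/lspan_mem; exists (m + (m' - k))%N, m, m', b, a'.
split=> //; [exact: leq_addr | lia | lia |].
rewrite highest_op_lpow //.
exact: (lpow_lowest bM).
Qed.

(** * Lengths of strings of a reachable element *)

(** If M_m = 0, a vector of ker e in the image of e^m already lies in the
    image of e^(m+1): no string of length m + 1 ends there. Then
    e^m (e^(m+1))^-1 is a section to which section_obstruction applies. *)
Lemma reachable_lowest_pred m a : reachable g e -> a \in M m.+1 -> a != 0 ->
  exists2 q, q \in M m & q != 0.
Proof.
move=> e_reach aM a0.
have [Mm0|Mm_n0] := eqVneq (M m) 0%VS; last first.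
  by exists (vpick (M m)); rewrite ?memv_pick ?vpick0.
pose K := (lker e :&: limg (lpow e m.+1))%VS.
have KP v : v \in K <-> e v = 0 /\ exists w, v = lpow e m.+1 w.
  rewrite memv_cap memv_ker; split.
    by case/andP=> /eqP ev /memv_imgP[w _ vE]; split; last exists w.
  by case=> -> [w ->]; rewrite eqxx memv_img ?memvf.
have KE w : e (lpow e m w) = 0 -> lpow e m w \in K.
  move=> ew; apply/KP; split=> //.
  have [t tM tE] := resolution_of_identity.
  suff : lpow e m w \in limg (lpow e m.+1).
    by case/memv_imgP => u _ ->; exists u.
  rewrite [w]tE linear_sum big_seq.
  apply: memv_suml => -[n [b a']] /= /tM[bM aM'].
  rewrite string_opE linear_sum; apply: memv_suml => k _ /=; rewrite linearZ /=.
  (* The term is a multiple of e^m e^(n-k) a', which is in the image of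
     e^(m+1) unless k = n; for k = n it vanishes when n < m, when n = m
     because M_m = 0, and when n > m because e^(m+1) w = 0. *)
  have [lt_kn|le_nk] := ltnP k n.
    rewrite -lpowD -(subnSK lt_kn) addnS -addSn lpowD.
    by apply: memvZ; rewrite memv_img ?memvf.
  have kn : (k : nat) = n by apply/eqP; rewrite eqn_leq le_nk -ltnS ltn_ord.
  have [lt_nm|le_mn] := ltnP n m.
    rewrite kn subnn lpow0 (lpow_lowest aM' lt_nm).
    by rewrite scaler0 mem0v.
  suff -> : phi w (lpow e k b) = 0 by rewrite mulr0 scale0r mem0v.
  rewrite kn; move: le_mn; rewrite leq_eqVlt => /orP[/eqP mn|lt_mn].
    by move: bM; rewrite -mn /= Mm0 memv0 => /eqP->; rewrite linear0 phi0r.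
  apply/eqP; have /eqP := phi_lpow n ge w b; rewrite -(subnK lt_mn).
  by rewrite lpowD lpowS ew linear0 phi0l eq_sym mulf_eq0 signr_eq0.
case: (@section_obstruction _ _ charF0 e
  (lpow e m \o (lpow e m.+1)^-1)%VF K (centraliser g e)) => //.
- apply/negP => /eqP K0; have: lpow e m.+1 a \in K.
    apply/KP; split; last by exists a.
    by rewrite -lpowS (lpow_lowest aM).
  rewrite K0 memv0 => /eqP /(lpow_lowest_inj aM (leqnn _)) a00.
  by rewrite a00 eqxx in a0.
- by move=> v /KP[].
- move=> v /KP[_ [w ->]]; rewrite comp_lfunE -lpowS limg_lfunVK //.
  by rewrite memv_img ?memvf.
- move=> x [_ /lie_comm xe] v /KP[ev [w vE]]; apply/KP.
  split; first by rewrite -xe ev linear0.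
  by exists (x w); rewrite vE lpow_comm.
- move=> x [_ /lie_comm xe] v /KP[ev [w vE]].
  have vK : v \in K by apply/KP; split; last exists w.
  have xvK : x v \in K.
    apply/KP; rewrite -xe ev linear0 vE; split=> //.
    by exists (x w); rewrite lpow_comm.
  rewrite !comp_lfunE; set S := _^-1%VF.
  have SP u : u \in K -> lpow e m.+1 (S u) = u.
    by case/KP=> _ [u' ->]; rewrite limg_lfunVK ?memv_img ?memvf.
  rewrite lpow_comm // -linearB; apply: KE.
  by rewrite -lpowS linearB /= -(lpow_comm _ _ xe) !SP ?subrr.
Qed.

(** * Brackets with elements of weight one *)

Lemma weight1_act n p q m a : p \in M n.+1 -> q \in M n -> a \in M m ->
  highest_op n.+1 p q a =
  (if m == n.+1 then phi (lpow e m a) p *: q else 0) -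
  (-1) ^+ eps * (-1) ^+ n.+1 *:
    (if m == n then phi (lpow e m a) q *: e p else 0).
Proof.
move=> pM qM aM; rewrite /highest_op add_lfunE opp_lfunE scale_lfunE.
rewrite -[a in LHS](lpow0 e) (string_op_lowest _ pM aM) //.
rewrite (string_op_lowest _ qM aM) // !subn0 subnn subSnn lpow0.
rewrite [lpow e 1 p]lpowS lpow0.
by case: eqVneq => [->|_]; case: eqVneq => [->|_].
Qed.

Local Notation W := (weight_centraliser g e h).

Lemma weight_centraliser_lie_prod k l : lie_prod (W k) (W l) `<=` W (k + l).
Proof.
apply: lspan_subset => [|c x y [[gx hx] [_ xe]] [[gy hy] [_ ye]]|].
- have g0 : g 0 by move=> u v; rewrite !zero_lfunE phi0l phi0r addr0.
  do !split=> //; apply/lfunP => v; rewrite lieE ?scale_lfunE !zero_lfunE.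
    by rewrite linear0 scaler0 subrr.
  by rewrite linear0 subrr.
- have gxy : g (c *: x + y).
    move=> u v; rewrite !(add_lfunE, scale_lfunE) phiDl phiDr phiZl phiZr.
    by rewrite addrACA -mulrDr gx gy mulr0 addr0.
  do !split=> //; apply/lfunP => v.
    move/lfunP/(_ v): hx; move/lfunP/(_ v): hy.
    rewrite !(lieE, scale_lfunE, add_lfunE) linearD linearZ /= => hy hx.
    rewrite opprD addrACA -scalerBr hx hy scalerDr !scalerA.
    by rewrite [_ * c]mulrC.
  rewrite lieE !(add_lfunE, scale_lfunE) (lie_comm xe) (lie_comm ye).
  by rewrite linearD linearZ /= subrr zero_lfunE.
- move=> _ [x [[gx hx] [_ /lie_comm xe]] [y [[gy hy] [_ /lie_comm ye]] <-]].
  have gxy : g (lie x y).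
    move=> u v; rewrite !lieE phiDl phiDr phiNl phiNr !isometry_lieNl //.
    rewrite !opprK; ring.
  do !split=> //; apply/lfunP => v; last first.
    by rewrite !lieE !xe !ye !xe linearB subrr zero_lfunE.
  have hX u : h (x u) = x (h u) + k%:~R *: x u.
    move/lfunP/(_ u): hx; rewrite lieE scale_lfunE => /eqP.
    by rewrite subr_eq addrC => /eqP.
  have hY u : h (y u) = y (h u) + l%:~R *: y u.
    move/lfunP/(_ u): hy; rewrite lieE scale_lfunE => /eqP.
    by rewrite subr_eq addrC => /eqP.
  rewrite scale_lfunE !lieE linearB /= !(hX, hY) !linearD !linearZ /=.
  rewrite -(opprD (x _)) -(addrA (x _)) -(addrA (- y _)) addrACA.
  rewrite [LHS]addrC addKr -!scalerDl intrD.
  by congr (_ *: _ + _); rewrite addrC.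
Qed.

Variable l : int.
Hypothesis l_ge0 : 0 <= l.
Hypothesis e_reach : reachable g e.

Local Notation L := (lie_prod (W 1) (W l)).

Lemma bracket_weight1 n p q N m m' a b : p \in M n.+1 -> q \in M n ->
  a \in M m -> b \in M m' -> (m <= N)%N -> (m' <= N)%N ->
  N.*2%:Z = l + m%:Z + m'%:Z ->
  L (highest_op N (highest_op n.+1 p q a) b +
     highest_op N a (highest_op n.+1 p q b)).
Proof.
move=> pM qM aM bM le_mN le_m'N Nl; have wx : W 1 (highest_op n.+1 p q).
  by apply: (highest_op_weight pM qM) => //; lia.
have [[gx _] [_ xe]] := wx.
rewrite -lie_highest_op //; apply: lspan_mem.
exists (highest_op n.+1 p q) => //.
exists (highest_op N a b) => //.
exact: (highest_op_weight aM bM).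
Qed.

(** With x = highest_op n.+1 b q and q' paired with q, x kills a and sends q'
    to a multiple of e b, so [x, C_(N-1)(a, q')] is a multiple of
    C_(N-1)(a, e b). *)
Lemma highest_op_far N m n a b : a \in M m -> b \in M n.+1 -> (m < n)%N ->
  (n < N)%N -> N.*2%:Z = l + 1 + m%:Z + n.+1%:Z -> L (highest_op N a b).
Proof.
move=> aM bM lt_mn lt_nN Nl.
have [->|b0] := eqVneq b 0; first by rewrite linear0; exact: lspan0.
have [q' q'M q'0] := reachable_lowest_pred e_reach bM b0.
have [q qM qq'] := lowest_dual q'M q'0.
case: N Nl lt_nN => // N Nl lt_nN.
have := bracket_weight1 (N := N) bM qM aM q'M.
rewrite (weight1_act bM qM aM) (weight1_act bM qM q'M).
rewrite (ltn_eqF lt_mn) (ltn_eqF (leqW lt_mn)) (ltn_eqF (ltnSn n)) eqxx.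
rewrite scaler0 subr0 sub0r.
rewrite [highest_op N 0 _]highest_op_sym linear0 scaler0 oppr0 add0r.
rewrite -scaleNr scalerA linearZ /= highest_op_er; last first.
  by rewrite (lpow_lowest aM) //; lia.
move=> LC; apply: lspan_scale_inv (LC _ _ _); [| lia..].
by rewrite mulf_neq0 // oppr_eq0 sg_neq0.
Qed.

(** Now x = highest_op m.+1 b q also moves a. Bracketing x with C_(N-1)(a, a),
    or highest_op m.+1 p a with C_N(b, b), gives a nonzero multiple of
    C_N(a, b) or 0, according to whether C_K is symmetric or skew in its two
    arguments, for K = N - 1 respectively K = N. By highest_op_sym these
    symmetries are opposite, so exactly one of the two brackets works. *)
Lemma highest_op_next N m a b : a \in M m -> b \in M m.+1 -> (m < N)%N ->
  N.*2%:Z = l + 1 + m%:Z + m.+1%:Z -> L (highest_op N a b).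
Proof.
move=> aM bM lt_mN Nl.
have [->|b0] := eqVneq b 0; first by rewrite linear0; exact: lspan0.
have [->|a0] := eqVneq a 0.
  by rewrite highest_op_sym linear0 scaler0 oppr0; exact: lspan0.
have [sgN|sgN] : sg N = 1 :> F \/ sg N = -1 :> F.
- by rewrite -(signr_odd _ N) -signr_addb; case: addb; [right|left].
- case: N Nl lt_mN sgN => // N Nl lt_mN sgN.
  have sgN' : sg N = -1 :> F.
    by move/eqP: sgN; rewrite exprS mulN1r mulrN eqr_oppLR => /eqP.
  have [q qM aq] := lowest_dual aM a0.
  have := bracket_weight1 (N := N) bM qM aM aM.
  rewrite (weight1_act bM qM aM) ltn_eqF // eqxx sub0r -scaleNr scalerA.
  set c := _ * phi _ _; have c0 : c != 0.
    by rewrite mulf_neq0 ?oppr_eq0 ?sg_neq0.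
  rewrite [highest_op N (c *: e b) a]highest_op_sym.
  rewrite [highest_op N a (c *: e b)]linearZ /= highest_op_er; last first.
    by rewrite (lpow_lowest aM) //; lia.
  rewrite sgN' scaleN1r opprK -scalerDl -mulr2n -mulr_natl => LC.
  apply: lspan_scale_inv (LC _ _ _); [| lia..].
  by rewrite mulf_neq0 ?(natr_neq0_char0 charF0).
have [p pM bp] := lowest_dual bM b0.
have := bracket_weight1 (N := N) pM aM bM bM.
rewrite (weight1_act pM aM bM) eqxx gtn_eqF // scaler0 subr0.
rewrite [highest_op N (_ *: a) b]highest_op_sym.
rewrite [highest_op N b (_ *: a)]linearZ /= [highest_op N b a]highest_op_sym.
rewrite sgN !scaleN1r !opprK -scalerDl -mulr2n -mulr_natl => LC.
apply: lspan_scale_inv (LC _ _ _); [| lia..].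
by rewrite mulf_neq0 ?(natr_neq0_char0 charF0).
Qed.

(** The bracket of highest_op m.+1 b q with C_(N-1)(a, q') is C_N(a, b) up to
    a nonzero scalar plus a multiple of C_(N-1)(q, q'), which involves M_m
    only. *)
Lemma highest_op_same N m a b : a \in M m -> b \in M m -> (m < N)%N ->
  N.*2%:Z = l + 1 + m%:Z + m%:Z -> L (highest_op N a b).
Proof.
elim: m N a b => [|m IHm] N a b aM bM lt_mN Nl;
  case: N Nl lt_mN => // N Nl lt_mN.
  rewrite -highest_op_er; last by rewrite (lpow_lowest aM).
  have := lpow_lowest bM (ltnSn 0).
  by rewrite lpowS lpow0 => ->; rewrite linear0; exact: lspan0.
have [->|b0] := eqVneq b 0; first by rewrite linear0; exact: lspan0.
have [q' q'M q'0] := reachable_lowest_pred e_reach bM b0.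
have [q qM qq'] := lowest_dual q'M q'0.
have := bracket_weight1 (N := N) bM qM aM q'M.
rewrite (weight1_act bM qM aM) (weight1_act bM qM q'M).
rewrite (ltn_eqF (ltnSn m)) (gtn_eqF (ltnSn m)) !eqxx scaler0 subr0 sub0r.
rewrite -scaleNr scalerA [highest_op N a (_ *: _)]linearZ /=.
rewrite highest_op_er; last first.
  by rewrite (lpow_lowest aM) //; lia.
set c := _ * phi _ _; have c0 : c != 0 by rewrite mulf_neq0 ?oppr_eq0 ?sg_neq0.
set X := highest_op N _ q' => LC; have LX : L X.
  rewrite /X highest_op_sym [highest_op N q' _]linearZ /= -scaleNr.
  by apply/lspanZ/lspanZ/IHm => //; lia.
have {}LC : L (X + c *: highest_op N.+1 a b) by apply: LC; lia.
apply: lspan_scale_inv c0 _; rewrite -[_ *: _](addKr X) addrC.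
exact: lspanB.
Qed.

Lemma highest_op_in_lie_prod N m m' a b : a \in M m -> b \in M m' ->
  (m <= N)%N -> (m' <= N)%N -> N.*2%:Z = l + 1 + m%:Z + m'%:Z ->
  L (highest_op N a b).
Proof.
wlog le_mm' : m m' a b / (m <= m')%N => [wlg|].
  case/orP: (leq_total m m') => le aM bM le_mN le_m'N Nl.
    exact: (wlg m m').
  rewrite highest_op_sym -scaleNr; apply: lspanZ; apply: (wlg m' m) => //; lia.
move=> aM bM le_mN le_m'N Nl; have [lt_mm'|le_m'm] := ltnP m m'.
  case: m' {le_mm'} bM le_m'N Nl lt_mm' => // n bM le_m'N Nl.
  rewrite ltnS leq_eqVlt => /orP[/eqP mn|lt_mn].
    by subst n; exact: (highest_op_next aM bM).
  exact: (highest_op_far aM bM).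
have mm' : m = m' by apply/eqP; rewrite eqn_leq le_mm'.
subst m'; apply: (highest_op_same aM bM) => //; lia.
Qed.

End IsometryAlgebra.

Theorem lemma10 (F : closedFieldType) (charF0 : [pchar F] =i pred0)
    (V : vectType F) (eps : bool) (phi : {hermitian V for eps & idfun})
    (phi_nondeg : nondegenerate phi) (e h f : 'End(V))
    (ge : isometry_lie phi e) (gh : isometry_lie phi h)
    (gf : isometry_lie phi f)
    (e_nilp : nilpotent_end e) (ehf : sl2_triple e h f)
    (e_reach : reachable (isometry_lie phi) e) (l : int) (l_ge0 : 0 <= l) :
  lie_prod (weight_centraliser (isometry_lie phi) e h 1)
           (weight_centraliser (isometry_lie phi) e h l)
  = weight_centraliser (isometry_lie phi) e h (l + 1).
Proof.
apply/seteqP; split=> [|x].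
  by rewrite addrC; exact: weight_centraliser_lie_prod.
move/(weight_centraliser_span charF0 ehf e_nilp phi_nondeg ge gh gf).
apply: lspan_lspan => _ [N [m [m' [a [b [[aM bM] le_mN le_m'N Nl ->]]]]]].
exact: (highest_op_in_lie_prod charF0 ehf e_nilp phi_nondeg ge gh gf l_ge0
  e_reach aM bM le_mN le_m'N Nl).
Qed.
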